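(* Let $G$ be a compactly covered locally compact topologically quasihamiltonian group, and let $c(G)$ be the connected component of the identity of $G$. Let $\phi$ be a continuous endomorphism of $G$ such that $\phi(c(G))=c(G)$ and $\ker\phi\leq c(G)$. Then $h_{alg}(\phi)=h_{alg}(\bar\phi)$, where $\bar\phi : G/c(G)\to G/c(G)$ is the induced map. In particular, if $\phi$ is a topological automorphism of $G$, then $\phi(c(G))=c(G)$ and $h_{alg}(\phi)=h_{alg}(\bar\phi)$.
   Context: All topological groups are Hausdorff. A topological group is compactly covered if each of its elements lies in a compact subgroup. A closed subgroup $N$ of a topological group $G$ is topologically quasinormal if $\overline{NL}=\overline{LN}$ for every closed subgroup $L$ of $G$; $G$ is topologically quasihamiltonian if every closed subgroup of $G$ is topologically quasinormal. A topological automorphism is a group automorphism that is also a homeomorphism. Algebraic entropy: let $G$ be a locally compact group with right Haar measure $\mu$ and $\phi$ a continuous endomorphism of $G$. For $U\subseteq G$ and $n\geq 1$ put $T_n(\phi,U)=U\cdot\phi(U)\cdots\phi^{n-1}(U)$. For $U$ a compact neighborhood of $e_G$ put $H_{alg}(\phi,U)=\limsup_{n\to\infty}\frac{\log\mu(T_n(\phi,U))}{n}$, and let $h_{alg}(\phi)\in[0,\infty]$ be the supremum of $H_{alg}(\phi,U)$ over all compact neighborhoods $U$ of $e_G$. The entropy of $\bar\phi$, $\bar\phi(g\,c(G))=\phi(g)c(G)$, is computed in the locally compact group $G/c(G)$. *)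

(* Defs.v *)
From HB Require Import structures.
From mathcomp Require Import all_boot all_order all_algebra.
From mathcomp Require Import all_classical all_reals all_analysis.

Set Implicit Arguments.
Unset Strict Implicit.
Unset Printing Implicit Defensive.

Import numFieldNormedType.Exports.

Local Open Scope ring_scope.
Local Open Scope classical_set_scope.
Local Open Scope group_scope.
Local Open Scope quotient_scope.

HB.mixin Record isTopologicalGroup G of Group G & PointedTopological G := {
  mulg_continuous : continuous (fun xy : G * G => xy.1 * xy.2) ;
  invg_continuous : continuous (fun x : G => x^-1) ;
}.

(* The Hausdorff axiom is not part of the structure.  The distinguished point
   carries no information; the library only requires one to build the Borel
   sigma-algebra as a measurable type. *)
#[short(type="topologicalGroupType")]
HB.structure Definition TopologicalGroup :=
  {G of isTopologicalGroup G & Group G & PointedTopological G}.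

Section subgroups.
Context {G : topologicalGroupType}.
Implicit Types A B H K L N : set G.

Definition mulset A B : set G := [set x * y | x in A & y in B].

Definition is_subgroup H : Prop :=
  [/\ H 1, forall x y, H x -> H y -> H (x * y) & forall x, H x -> H x^-1].

Definition closed_subgroup H : Prop := is_subgroup H /\ closed H.

Definition topologically_quasinormal N : Prop :=
  closed_subgroup N /\
  forall L, closed_subgroup L -> closure (mulset N L) = closure (mulset L N).

End subgroups.

Definition topologically_quasihamiltonian (G : topologicalGroupType) : Prop :=
  forall N : set G, closed_subgroup N -> topologically_quasinormal N.

Definition compactly_covered (G : topologicalGroupType) : Prop :=
  forall g : G, exists K : set G, [/\ is_subgroup K, compact K & K g].

Definition topological_automorphism (G : topologicalGroupType)
    (phi : {multiplicative G -> G}) : Prop :=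
  continuous phi /\
  exists psi : G -> G, [/\ cancel phi psi, cancel psi phi & continuous psi].

Definition identity_component (G : topologicalGroupType) : set G :=
  connected_component [set: G] 1.
Arguments identity_component : clear implicits.

Section translations.
Context {G : topologicalGroupType}.

Lemma mull_continuous (a : G) : continuous (fun x : G => a * x).
Proof.
move=> x; apply: (@continuous_comp _ _ _ (fun x => (a, x))
  (fun xy : G * G => xy.1 * xy.2)); last exact: mulg_continuous.
by apply: cvg_pair => //=; exact: cvg_cst.
Qed.

Lemma mulr_continuous (a : G) : continuous (fun x : G => x * a).
Proof.
move=> x; apply: (@continuous_comp _ _ _ (fun x => (x, a))
  (fun xy : G * G => xy.1 * xy.2)); last exact: mulg_continuous.
by apply: cvg_pair => //=; exact: cvg_cst.
Qed.

Lemma conj_continuous (a : G) : continuous (fun x : G => x ^ a).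
Proof.
move=> x; apply: (@continuous_comp _ _ _ (fun x => x * a) (fun x => a^-1 * x)).
  exact: mulr_continuous.
exact: mull_continuous.
Qed.

End translations.

Section identity_component_theory.
Context {G : topologicalGroupType}.
Local Notation c := (identity_component G).

Lemma connected_image_component (f : G -> G) (x y : G) :
  continuous f -> c x -> c (f x) -> c y -> c (f y).
Proof.
move=> cf cx cfx cy.
have : connected_component setT (f x) (f y).
  have cfc : connected (f @` c).
    apply: connected_continuous_connected; first exact: component_connected.
    exact: continuous_subspaceT.
  apply: (@connected_component_max _ _ (f @` c)) => //; exact: imageP.
exact: connected_component_trans.
Qed.

Lemma identity_component1 : c 1.
Proof. exact: connected_component_refl. Qed.

Lemma identity_componentM x y : c x -> c y -> c (x * y).
Proof.
move=> cx; apply: (connected_image_component (f := fun y => x * y) (x := 1)).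
- exact: mull_continuous.
- exact: identity_component1.
- by rewrite mulg1.
Qed.

Lemma identity_componentV x : c x -> c x^-1.
Proof.
move=> cx; rewrite -[x^-1]mulg1.
apply: (connected_image_component (f := fun y => x^-1 * y) (x := x)) => //.
- exact: mull_continuous.
- by rewrite mulVg; exact: identity_component1.
- exact: identity_component1.
Qed.

Lemma identity_componentJ x y : c x -> c (x ^ y).
Proof.
apply: (connected_image_component (f := fun x => x ^ y) (x := 1)).
- exact: conj_continuous.
- exact: identity_component1.
- by rewrite conj1g; exact: identity_component1.
Qed.

Lemma identity_component_subgroup : is_subgroup c.
Proof.
split; [exact: identity_component1|exact: identity_componentM|].
exact: identity_componentV.
Qed.

Definition coset_rel : rel G := fun x y => `[< c (x^-1 * y) >].

Lemma coset_rel_equiv : equiv_class_of coset_rel.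
Proof.
split=> [x|x y|y x z].
- by apply/asboolP; rewrite mulVg; exact: identity_component1.
- apply/idP/idP => /asboolP h; apply/asboolP;
  by move/identity_componentV: h; rewrite invgM invgK.
- move=> /asboolP xy /asboolP yz; apply/asboolP.
  by have := identity_componentM xy yz; rewrite mulgA mulgK.
Qed.

Canonical coset_equiv : equiv_rel G := EquivRelPack coset_rel_equiv.

End identity_component_theory.

(* The group G / c(G) of left cosets, with the quotient topology. *)
Definition component_quotient (G : topologicalGroupType) : Type :=
  quotient_topology {eq_quot (@coset_equiv G)}.

Section component_quotient_group.
Context {G : topologicalGroupType}.
Local Notation c := (identity_component G).
Local Notation Q := (component_quotient G).

HB.instance Definition _ := PointedTopological.on Q.
HB.instance Definition _ := Quotient.on Q.

Definition qproj (x : G) : Q := \pi_Q x.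

Lemma qproj_eq x y : qproj x = qproj y <-> c (x^-1 * y).
Proof.
have /rwP[h1 h2] := @eqmodP _ (@coset_equiv G) x y.
by split=> [/h1/asboolP|h]; [|apply: h2; exact/asboolP].
Qed.

Lemma qproj_repr (q : Q) : qproj (repr q) = q.
Proof. exact: reprK. Qed.

Definition qmul (p q : Q) : Q := qproj (repr p * repr q).
Definition qone : Q := qproj 1.
Definition qinv (q : Q) : Q := qproj (repr q)^-1.

Lemma qprojM x y : qmul (qproj x) (qproj y) = qproj (x * y).
Proof.
apply/qproj_eq.
have /qproj_eq hx := qproj_repr (qproj x).
have /qproj_eq hy := qproj_repr (qproj y).
set a := repr _ in hx *; set b := repr _ in hy *.
have := identity_componentM (identity_componentJ y hx) (identity_componentV hy).
move=> /identity_componentV h.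
have := identity_componentM hy (identity_componentJ y hx).
by rewrite conjgE invgM !mulgA mulgK.
Qed.

Lemma qprojV x : qinv (qproj x) = qproj x^-1.
Proof.
apply/qproj_eq; have /qproj_eq := qproj_repr (qproj x).
set a := repr _ => /identity_componentV /(identity_componentJ a^-1).
by rewrite conjgE !invgM !invgK !mulgA mulgK.
Qed.

Lemma qmulA : associative qmul.
Proof.
move=> x y z; rewrite -(qproj_repr x) -(qproj_repr y) -(qproj_repr z).
by rewrite !qprojM mulgA.
Qed.

Lemma qmul1 : left_id qone qmul.
Proof. by move=> x; rewrite -(qproj_repr x) qprojM mul1g. Qed.

Lemma qmulr1 : right_id qone qmul.
Proof. by move=> x; rewrite -(qproj_repr x) qprojM mulg1. Qed.

Lemma qmulV : left_inverse qone qinv qmul.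
Proof. by move=> x; rewrite -(qproj_repr x) qprojV qprojM mulVg. Qed.

Lemma qmulrV : right_inverse qone qinv qmul.
Proof. by move=> x; rewrite -(qproj_repr x) qprojV qprojM mulgV. Qed.

HB.instance Definition _ := isGroup.Build Q qmulA qmul1 qmulr1 qmulV qmulrV.

Lemma qproj_continuous : continuous qproj.
Proof. exact: pi_continuous. Qed.

Lemma qproj_open (U : set G) : open U -> open (qproj @` U).
Proof.
move=> oU; suff : open (qproj @^-1` (qproj @` U)) by [].
rewrite (_ : _ @^-1` _ = \bigcup_(a in c) ((fun x => x * a) @^-1` U)).
  apply: bigcup_open => a _; apply: open_comp => // x _.
  exact: mulr_continuous.
apply/seteqP; split=> [x [u Uu /esym/qproj_eq h]|x [a ca Uxa]].
  by exists (x^-1 * u) => //=; rewrite mulgA mulgV mul1g.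
by exists (x * a) => //; apply/esym/qproj_eq; rewrite mulgA mulVg mul1g.
Qed.

Lemma qproj_nbhs (x : G) (U : set G) : nbhs x U -> nbhs (qproj x) (qproj @` U).
Proof.
rewrite nbhsE => -[V [oV Vx] VU].
apply: (@filterS _ (nbhs (qproj x)) _ (qproj @` V)).
  exact: image_subset.
by apply: open_nbhs_nbhs; split; [exact: qproj_open|exact: imageP].
Qed.

Lemma qmul_continuous : continuous (fun pq : Q * Q => pq.1 * pq.2).
Proof.
move=> [p q] U /=; rewrite -(qproj_repr p) -(qproj_repr q).
rewrite -[_ * _]/(qmul _ _) qprojM => /qproj_continuous.
move=> /(@mulg_continuous G (repr p, repr q))[[A B] /= [nA nB] AB].
exists (qproj @` A, qproj @` B) => /=.
  by split; exact: qproj_nbhs.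
move=> [_ _] /= [[x Ax <-] [y By <-]].
by rewrite -[_ * _]/(qmul _ _) qprojM; exact: (AB (x, y)).
Qed.

Lemma qinv_continuous : continuous (fun q : Q => q^-1).
Proof.
move=> q U /=; rewrite -(qproj_repr q) -[_^-1]/(qinv _) qprojV.
move=> /qproj_continuous /(@invg_continuous G (repr q)) nU.
apply: (filterS _ (qproj_nbhs nU)) => _ [x Ux <-] /=.
by rewrite -[_^-1]/(qinv _) qprojV.
Qed.

HB.instance Definition _ :=
  isTopologicalGroup.Build Q qmul_continuous qinv_continuous.

Definition component_map (phi : G -> G) (q : Q) : Q := qproj (phi (repr q)).

(* No hypothesis relating phi and c(G) is needed for component_map to be the map
   g c(G) |-> phi(g) c(G): a continuous phi maps c(G) into itself. *)
Lemma component_map_qproj (phi : {multiplicative G -> G}) (g : G) :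
  continuous phi -> component_map phi (qproj g) = qproj (phi g).
Proof.
move=> cphi; apply/qproj_eq.
have phi1 : phi 1 = 1 by apply: (mulgI (phi 1)); rewrite -gmulfM !mulg1.
have phiV x : (phi x)^-1 = phi x^-1.
  by apply: (mulgI (phi x)); rewrite -gmulfM !mulgV.
rewrite phiV -gmulfM; apply: (connected_image_component (x := 1)) => //.
- exact: identity_component1.
- by rewrite phi1; exact: identity_component1.
- by apply/qproj_eq; exact: qproj_repr.
Qed.

End component_quotient_group.

Section entropy.
Context {R : realType} {G : topologicalGroupType}.
Local Open Scope ereal_scope.

Local Notation borelType := (g_sigma_algebraType (@open G)).

(* Regularity is part of the definition: without second countability,
   uniqueness of Haar measure up to scaling fails for mere Borel measures. *)
Definition right_haar_measure (mu : {measure set borelType -> \bar R}) : Prop :=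
  [/\ mu [set: G] != 0,
      forall (A : set G) (g : G), (@open G).-sigma.-measurable A ->
        mu [set (x * g)%g | x in A] = mu A,
      forall K : set G, compact K -> mu K < +oo,
      forall A : set G, (@open G).-sigma.-measurable A ->
        mu A = ereal_inf [set mu U | U in [set U | open U /\ A `<=` U]] &
      forall U : set G, open U ->
        mu U = ereal_sup [set mu K | K in [set K | compact K /\ K `<=` U]]].

Definition trajectory (phi : G -> G) (U : set G) (n : nat) : set G :=
  \big[mulset/[set 1%g]]_(i < n) (iter i phi @` U).

(* The junk term at n = 0 does not affect the limsup. *)
Definition entropy_at (mu : {measure set borelType -> \bar R})
    (phi : G -> G) (U : set G) : \bar R :=
  limn_esup (fun n : nat => lne (mu (trajectory phi U n)) * (n%:R^-1)%R%:E).

Definition algebraic_entropy (mu : {measure set borelType -> \bar R})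
    (phi : G -> G) : \bar R :=
  ereal_sup [set entropy_at mu phi U
            | U in [set U : set G | compact U /\ nbhs 1%g U]].

End entropy.

(* Main.v *)
Require Import Defs.
From mathcomp Require Import all_boot all_order all_algebra.
From mathcomp Require Import finmap.
From mathcomp Require Import all_classical all_reals all_analysis.

(** Everything rests on the existence of a compact open subgroup W of G.

    In a topologically quasihamiltonian group the product HK of two compact
    subgroups is again a compact subgroup: HK and KH are compact, hence closed,
    so the equality of their closures says HK = KH.  With compact coverage, it
    follows that every finite subset of G lies in a compact subgroup
    ([finite_sub_compact_subgroup]).  Let U be a compact symmetric neighborhood
    of 1.  The compact set UU is covered by finitely many translates of U, so
    UU is contained in UK for some compact subgroup K.  Then UUK is contained in
    UK: left multiplication by an element of U preserves UK, and the elements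
    that preserve UK together with their inverses form an open subgroup W
    contained in the compact set UK ([exists_compact_open_subgroup]).

    Being open, W is also closed, so it contains the connected set c(G).  The
    cosets W x are then unions of cosets of c(G), and the projection
    pi : G -> G / c(G) maps disjoint cosets of W onto disjoint cosets of pi(W).
    A compact set T with W T = T is a disjoint union of N cosets of W, of right
    Haar measure N mu(W), while its image has measure N nu(pi(W)).  The two
    measures of such sets are therefore proportional ([haar_saturated]), which
    replaces any appeal to the uniqueness of Haar measure.

    The trajectories of W U are sets of this kind as W W U = W U, and pi maps
    them onto the trajectories of pi(W U) under the induced map.  As every
    compact neighborhood of 1 in G is contained in some W U, and every compact
    neighborhood of 1 in G / c(G) in some pi(W U), comparing trajectories gives
    both inequalities between the entropies: a constant factor in the measures
    does not change the exponential growth rate ([log_growth_le]).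

    For a topological automorphism, both the map and its inverse send the
    connected component c(G) into itself. *)

Set Implicit Arguments.
Unset Strict Implicit.
Unset Printing Implicit Defensive.

Import Order.TTheory GRing.Theory Num.Theory.

Local Open Scope ring_scope.
Local Open Scope classical_set_scope.
Local Open Scope group_scope.

(** * Products of sets *)

Section ProductSets.
Context {G : topologicalGroupType}.
Implicit Types A B C D H K U V W : set G.

Lemma mulsetS A B C D : A `<=` C -> B `<=` D -> mulset A B `<=` mulset C D.
Proof. by move=> AC BD _ [a /AC Ca [b /BD Db <-]]; exists a => //; exists b. Qed.

Lemma mulset_setX A B :
  mulset A B = (fun xy : G * G => xy.1 * xy.2) @` (A `*` B).
Proof.
apply/seteqP; split=> [_ [a Aa [b Bb <-]]|_ [[a b] /= [Aa Bb] <-]].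
  by exists (a, b).
by exists a => //; exists b.
Qed.

Lemma mulsetA A B C : mulset A (mulset B C) = mulset (mulset A B) C.
Proof.
apply/seteqP; split=> [_ [a Aa [_ [b Bb [d Cd <-]] <-]]|
                       _ [_ [a Aa [b Bb <-]] [d Cd <-]]].
  by exists (a * b); [exists a => //; exists b|exists d => //; rewrite mulgA].
by exists a => //; exists (b * d); [exists b => //; exists d|rewrite mulgA].
Qed.

Lemma mulset_subgroup H : is_subgroup H -> mulset H H = H.
Proof.
move=> [H1 HM _]; apply/seteqP; split=> [_ [x Hx [y Hy <-]]|x Hx]; first exact: HM.
by exists 1 => //; exists x => //; rewrite mul1g.
Qed.

Lemma mulset_subset A B : A 1 -> B `<=` mulset A B.
Proof. by move=> A1 b Bb; exists 1 => //; exists b => //; rewrite mul1g. Qed.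

Lemma compact_mulset A B : compact A -> compact B -> compact (mulset A B).
Proof.
move=> cA cB; rewrite mulset_setX.
apply: continuous_compact; last exact: compact_setX.
by apply: continuous_subspaceT => x; exact: mulg_continuous.
Qed.

(** Right rather than left translates of V, because the Haar measures below are
    right invariant. *)
Lemma compact_mulset_cover A V : compact A -> nbhs 1 V ->
  exists s : seq G, A `<=` mulset V [set` s].
Proof.
move=> cA nV.
have := cA; rewrite compact_cover.
move=> /(_ G A (fun x => (fun y => y * x^-1) @^-1` V^°)) [].
- move=> x _; apply: open_comp; last exact: open_interior.
  by move=> y _; exact: mulr_continuous.
- move=> x Ax; exists x => //=; rewrite mulgV; exact: nV.
- move=> D _ AD; exists (enum_fset D) => x /AD[y Dy /interior_subset Vxy].
  by exists (x * y^-1) => //; exists y => //; rewrite mulgVK.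
Qed.

End ProductSets.

(** * Compact open subgroups *)

Section CompactOpenSubgroup.
Context {G : topologicalGroupType}.
Implicit Types A B C H K U V W : set G.
Hypothesis hausdorffG : hausdorff_space G.

Lemma subgroup_nbhs_open H : is_subgroup H -> nbhs 1 H -> open H.
Proof.
move=> [_ HM _] nH; rewrite openE => x Hx.
have : nbhs x ((fun y => x^-1 * y) @^-1` H).
  by apply: mull_continuous; rewrite mulVg.
by apply: filterS => y Hxy; rewrite -(mulVKg x y); exact: HM.
Qed.

Lemma open_subgroup_closed H : is_subgroup H -> open H -> closed H.
Proof.
move=> [H1 HM HV] oH x clHx.
have : nbhs x ((fun y => x^-1 * y) @^-1` H).
  by apply: mull_continuous; rewrite mulVg; exact: open_nbhs_nbhs.
move=> /clHx[y [Hy Hxy]].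
have -> : x = y * (x^-1 * y)^-1 by rewrite invgM invgK mulVKg.
by apply: HM => //; exact: HV.
Qed.

(** An open subgroup is closed, so its intersection with the connected set c(G) is a
    nonempty clopen subset of c(G). *)
Lemma identity_component_sub_open H :
  is_subgroup H -> open H -> identity_component G `<=` H.
Proof.
move=> sH oH; have cH := open_subgroup_closed sH oH.
suff <- : identity_component G `&` H = identity_component G by move=> x [].
apply: (@component_connected _ setT 1).
- by exists 1; split; [exact: identity_component1|case: sH].
- by exists H.
- by exists H.
Qed.

(** Quasinormality only gives equality of the closures of HK and KH, but these
    products are compact, hence already closed; and HK is a subgroup as soon as
    HK = KH. *)
Lemma compact_subgroup_mulset H K :
  topologically_quasihamiltonian G ->
  is_subgroup H -> compact H -> is_subgroup K -> compact K ->
  is_subgroup (mulset H K) /\ compact (mulset H K).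
Proof.
move=> qG sH cH sK cK.
have cl A : compact A -> closed A by exact: compact_closed.
have cHK : compact (mulset H K) by exact: compact_mulset.
have HK : mulset H K = mulset K H.
  have [_ /(_ K)] := qG H (conj sH (cl H cH)).
  rewrite -(closure_id _).1; last exact: cl.
  rewrite -(closure_id _).1; last by apply: cl; exact: compact_mulset.
  by apply; split => //; exact: cl.
split => //; have [H1 _ HV] := sH; have [K1 _ KV] := sK; split.
- by exists 1 => //; exists 1 => //; rewrite mulg1.
- move=> x y HKx HKy; have : mulset (mulset H K) (mulset H K) (x * y).
    by exists x => //; exists y.
  by rewrite {2}HK -mulsetA (mulsetA K) mulset_subgroup// -HK mulsetA
    mulset_subgroup.
- move=> _ [h Hh [k Kk <-]]; rewrite HK invgM.
  by exists k^-1; [exact: KV|exists h^-1 => //; exact: HV].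
Qed.

(** The compact subgroups containing the successive elements are multiplied
    together. *)
Lemma finite_sub_compact_subgroup (s : seq G) :
  topologically_quasihamiltonian G -> compactly_covered G ->
  exists K, [/\ is_subgroup K, compact K & [set` s] `<=` K].
Proof.
move=> qG ccG; elim: s => [|x s [K [sK cK Ks]]].
  by have [K [sK cK _]] := ccG 1; exists K; split=> // x.
have [H [sH cH Hx]] := ccG x; have [sHK cHK] := compact_subgroup_mulset qG sH cH sK cK.
have [H1 _ _] := sH; have [K1 _ _] := sK.
exists (mulset H K); split=> // y /=; rewrite in_cons => /orP[/eqP->|/Ks Ky].
  by exists x => //; exists 1 => //; rewrite mulg1.
exact: mulset_subset.
Qed.

Lemma compact_symmetric_nbhs1 : locally_compact [set: G] ->
  exists U, [/\ compact U, nbhs 1 U & forall x, U x -> U x^-1].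
Proof.
move=> /(_ 1 I) [D wD [cD _]].
have nD : nbhs 1 D by apply: (@filterS _ (nbhs (1 : G)) _ _ _ _ wD) => x; exact.
exists (D `|` [set x^-1 | x in D]); split.
- apply: compactU => //; apply: continuous_compact => //.
  by apply: continuous_subspaceT => x; exact: invg_continuous.
- by apply: filterS nD => x; left.
- by move=> x [Dx|[y Dy <-]]; [right; exists x|left; rewrite invgK].
Qed.

(** The subgroup is found inside a compact set P = UK that is stable under left
    multiplication by a neighborhood U of 1: W consists of the x such that
    x P and x^-1 P lie in P, and W is contained in P because 1 is in P. *)
Lemma exists_compact_open_subgroup :
  locally_compact [set: G] -> compactly_covered G ->
  topologically_quasihamiltonian G ->
  exists W, [/\ is_subgroup W, compact W & open W].
Proof.
move=> lcG ccG qG; have [U [cU nU UV]] := compact_symmetric_nbhs1 lcG.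
have [s Us] := compact_mulset_cover (compact_mulset cU cU) nU.
have [K [sK cK Ks]] := finite_sub_compact_subgroup s qG ccG.
have [K1 KM _] := sK.
pose P := mulset U K.
have cP : compact P by exact: compact_mulset.
have UP x : U x -> mulset [set x] P `<=` P.
  move=> Ux; apply: (@subset_trans _ (mulset (mulset U U) K)).
    by rewrite -mulsetA; apply: mulsetS => // _ ->.
  (* UU lies in U s with s inside K, whence UUK lies in UKK = UK. *)
  apply: subset_trans (mulsetS Us (fun x Kx => Kx)) _.
  rewrite -mulsetA; apply: mulsetS => // _ [x' /Ks Kx' [k Kk <-]]; exact: KM.
pose W := [set x | mulset [set x] P `<=` P /\ mulset [set x^-1] P `<=` P].
have mul1 x A y : mulset [set x] A y <-> A (x^-1 * y).
  split=> [[_ -> [b Ab <-]]|Ay]; first by rewrite mulKg.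
  by exists x => //; exists (x^-1 * y) => //; rewrite mulVKg.
have UW : U `<=` W by move=> x Ux; split; apply: UP => //; exact: UV.
have sW : is_subgroup W.
  have WM x y : mulset [set x] P `<=` P -> mulset [set y] P `<=` P ->
      mulset [set x * y] P `<=` P.
    move=> xP yP z /mul1; rewrite invgM -mulgA => Pz.
    by apply: xP; apply/mul1; apply: yP; apply/mul1.
  split.
  - by split=> z /mul1; rewrite ?invg1 ?mul1g ?invg1 ?mul1g.
  - move=> x y [x1 x2] [y1 y2]; split; first exact: WM.
    by rewrite invgM; exact: WM.
  - by move=> x [x1 x2]; split; rewrite ?invgK.
have oW : open W by apply: subgroup_nbhs_open => //; exact: filterS nU.
exists W; split=> //; apply: (@subclosed_compact _ _ P) => //.
  exact: open_subgroup_closed.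
move=> x [xP _]; apply: xP; apply/mul1; rewrite mulVg.
by exists 1; [exact: nbhs_singleton|exists 1 => //; rewrite mul1g].
Qed.

End CompactOpenSubgroup.

(** * The projection onto the group of components *)

Section ComponentQuotient.
Context {G : topologicalGroupType}.
Implicit Types A B W : set G.

(** A connected component is closed, so the x, y with x^-1 y outside c(G) form an
    open set; two points of the quotient are separated by the projections of a
    box inside it. *)
Lemma component_quotient_hausdorff : hausdorff_space (component_quotient G).
Proof.
move=> p q pq; apply: contrapT => npq.
have cl : closed (identity_component G).
  by apply: component_closed; exact: closedT.
have ncpq : (~` identity_component G) ((repr p)^-1 * repr q).
  by move=> /qproj_eq; rewrite !qproj_repr.
have [[A B] /= [nA nB] AB] : nbhs (repr p, repr q)
    [set xy : G * G | (~` identity_component G) (xy.1^-1 * xy.2)].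
  apply: (@continuous_comp _ _ _ (fun xy : G * G => (xy.1^-1, xy.2))
    (fun xy : G * G => xy.1 * xy.2)) => /=.
  - apply: cvg_pair => /=; last exact: cvg_snd.
    by apply: cvg_comp; [exact: cvg_fst|exact: invg_continuous].
  - exact: mulg_continuous.
  - by apply: open_nbhs_nbhs; split => //; exact: closed_openC.
have nqA := qproj_nbhs nA; have nqB := qproj_nbhs nB.
rewrite !qproj_repr in nqA nqB.
have [_ [[a Aa <-] [b Bb /esym/qproj_eq cab]]] := pq _ _ nqA nqB.
exact: (AB (a, b)).
Qed.

Lemma qproj_mul (x y : G) : qproj (x * y) = qproj x * qproj y.
Proof. by rewrite -qprojM. Qed.

Lemma image_qproj_mulset A B :
  qproj @` mulset A B = mulset (qproj @` A) (qproj @` B).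
Proof.
apply/seteqP; split=> [_ [_ [a Aa [b Bb <-]] <-]|_ [_ [a Aa <-] [_ [b Bb <-] <-]]].
  by rewrite qproj_mul; exists (qproj a); [exists a|exists (qproj b) => //; exists b].
by exists (a * b); [exists a => //; exists b|rewrite qproj_mul].
Qed.

Lemma compact_image_qproj A : compact A -> compact (qproj @` A).
Proof.
by apply: continuous_compact; apply: continuous_subspaceT; exact: qproj_continuous.
Qed.

Lemma is_subgroup_image_qproj W : is_subgroup W -> is_subgroup (qproj @` W).
Proof.
move=> [W1 WM WV]; split.
- by exists 1.
- by move=> _ _ [x Wx <-] [y Wy <-]; exists (x * y); [exact: WM|rewrite qproj_mul].
- by move=> _ [x Wx <-]; exists x^-1; [exact: WV|rewrite -qprojV].
Qed.

Lemma qproj_subgroupP W x : is_subgroup W -> identity_component G `<=` W ->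
  (qproj @` W) (qproj x) <-> W x.
Proof.
move=> [W1 WM WV] cW; split=> [[w Ww /qproj_eq /cW Wwx]|Wx]; last by exists x.
by rewrite -(mulVKg w x); exact: WM.
Qed.

(** P is covered by finitely many translates of the open set pi(W), each of which
    is the image of a compact translate of W. *)
Lemma qproj_compact_lift (P : set (component_quotient G)) W :
  is_subgroup W -> compact W -> open W -> compact P ->
  exists U, [/\ compact U, nbhs 1 U & P `<=` qproj @` U].
Proof.
move=> [W1 _ _] cW oW cP.
have nW : nbhs 1 W by exact: open_nbhs_nbhs.
have nqW : nbhs 1 (qproj @` W) by exact: (qproj_nbhs nW).
have [s Ps] := compact_mulset_cover cP nqW.
exists (mulset W [set` 1 :: map repr s]); split.
- apply: compact_mulset => //; apply: finite_compact.
  exact: finite_seq.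
- apply: filterS nW => w Ww; exists w => //; exists 1; last by rewrite mulg1.
  by rewrite /= mem_head.
- move=> _ /Ps[_ [w Ww <-] [q /= qs <-]]; exists (w * repr q).
    by exists w => //; exists (repr q) => //=; rewrite in_cons map_f ?orbT.
  by rewrite qproj_mul qproj_repr.
Qed.

End ComponentQuotient.

(** * Right Haar measure of unions of cosets *)

Section Haar.
Context {R : realType} {G : topologicalGroupType}.
Hypothesis hausdorffG : hausdorff_space G.
Variable mu : {measure set (g_sigma_algebraType (@open G)) -> \bar R}.
Hypothesis haar_mu : right_haar_measure mu.
Implicit Types A B C W : set G.

Lemma open_borel A : open A -> (@open G).-sigma.-measurable A.
Proof. exact: sub_sigma_algebra. Qed.

Lemma compact_borel A : compact A -> (@open G).-sigma.-measurable A.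
Proof.
move=> /(compact_closed hausdorffG) cA; rewrite -(setCK A).
by apply: measurableC; apply: open_borel; exact: closed_openC.
Qed.

Lemma mulset1E A (g : G) : mulset A [set g] = [set x * g | x in A].
Proof.
apply/seteqP; split=> [_ [a Aa [_ -> <-]]|_ [a Aa <-]]; first by exists a.
by exists a => //; exists g.
Qed.

Lemma haar_translate A g : compact A -> mu (mulset A [set g]) = mu A.
Proof.
by case: haar_mu => _ invmu _ _ _ cA; rewrite mulset1E invmu//; exact: compact_borel.
Qed.

Lemma haar_compact_le A B : compact A -> compact B -> A `<=` B -> (mu A <= mu B)%E.
Proof.
by move=> cA cB AB; apply: le_measure; rewrite ?inE//; exact: compact_borel.
Qed.

Lemma haar_compactU A B : compact A -> compact B -> A `&` B = set0 ->
  mu (A `|` B) = (mu A + mu B)%E.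
Proof. by move=> cA cB AB; apply: measureU => //; exact: compact_borel. Qed.

Lemma haar_compact_fin A : compact A -> mu A \is a fin_num.
Proof.
by case: haar_mu => _ _ fin _ _ /fin muA; rewrite ge0_fin_numE.
Qed.

Lemma mulset_cons A (x : G) s :
  mulset A [set` x :: s] = mulset A [set x] `|` mulset A [set` s].
Proof.
apply/seteqP; split=> [_ [a Aa [y /= + <-]]|].
  rewrite in_cons => /orP[/eqP ->|ys]; [left|right]; exists a => //; first by exists x.
  by exists y.
move=> y [[a Aa [_ -> <-]]|[a Aa [z /= zs <-]]]; exists a => //.
  by exists x => //; rewrite /= mem_head.
by exists z => //; rewrite /= in_cons zs orbT.
Qed.

Lemma mulset_nil A : mulset A [set` [::]] = set0.
Proof. by apply/seteqP; split=> [y [a _ [x]]|]. Qed.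

(** If A had measure 0, so would every compact set, being covered by finitely many
    translates of A, and then G itself by inner regularity. *)
Lemma haar_compact_gt0 A : compact A -> nbhs 1 A -> (0 < mu A)%E.
Proof.
move=> cA nA; rewrite lt0e measure_ge0 andbT; apply/negP => /eqP muA0.
have [muT _ _ _ /(_ _ openT) muTE] := haar_mu.
suff : (mu [set: G] <= 0)%E by rewrite le_eqVlt ltNge measure_ge0 orbF (negbTE muT).
(* Inner regularity, applied to the open set G. *)
rewrite muTE; apply: ge_ereal_sup => _ [K [cK _] <-].
have [s Ks] := compact_mulset_cover cK nA.
have cs (t : seq G) : compact (mulset A [set` t]).
  by apply: compact_mulset => //; apply: finite_compact; exact: finite_seq.
apply: le_trans (haar_compact_le cK (cs s) Ks) _.
elim: s {Ks} => [|x s IH]; first by rewrite mulset_nil measure0.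
rewrite mulset_cons; apply: le_trans (measureU2 _ _ _) _.
- by apply: compact_borel; apply: compact_mulset => //; exact: compact_set1.
- exact: compact_borel.
- by rewrite [X in (X + _)%E]haar_translate// muA0 add0r.
Qed.

End Haar.

Section CosetCounting.
Context {R : realType} {G : topologicalGroupType}.
Hypothesis hausdorffG : hausdorff_space G.
Variable mu : {measure set (g_sigma_algebraType (@open G)) -> \bar R}.
Variable nu : {measure set (g_sigma_algebraType (@open (component_quotient G)))
  -> \bar R}.
Hypothesis haar_mu : right_haar_measure mu.
Hypothesis haar_nu : right_haar_measure nu.
Variable W : set G.
Hypothesis subgroupW : is_subgroup W.
Hypothesis compactW : compact W.
Hypothesis openW : open W.

Let mulset_seq_coset (x : G) (s : seq G) : mulset W [set` s] x ->
  mulset W [set x] `<=` mulset W [set` s].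
Proof.
move=> Wsx _ [w Ww [_ -> <-]]; rewrite -(mulset_subgroup subgroupW) -mulsetA.
by exists w => //; exists x.
Qed.

(** N is the number of distinct cosets W x for x in s.  The same N serves for mu
    and nu because c(G) lies in W: two cosets of W that are disjoint in G remain
    disjoint in the quotient. *)
Lemma haar_coset_count (s : seq G) : exists N : nat,
  mu (mulset W [set` s]) = (N%:R%:E * mu W)%E /\
  nu (qproj @` mulset W [set` s]) = (N%:R%:E * nu (qproj @` W))%E.
Proof.
have [W1 WM WV] := subgroupW.
have cW : identity_component G `<=` W by exact: identity_component_sub_open.
have hQ := @component_quotient_hausdorff G.
have cs (A : set G) : finite_set A -> compact (mulset W A).
  by move=> fA; apply: compact_mulset => //; exact: finite_compact.
elim: s => [|x s [N [muN nuN]]].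
  by exists 0; rewrite mulset_nil image_set0 !measure0 !mul0e.
rewrite mulset_cons image_setU; have [Wsx|Wsx] := pselect (mulset W [set` s] x).
  exists N; split; [rewrite -muN|rewrite -nuN]; congr (_ _); apply/setUidPr.
    exact: mulset_seq_coset.
  by apply: image_subset; exact: mulset_seq_coset.
have muS (a b : \bar R) : a = b -> (0 <= b)%E ->
    (a + N%:R%:E * b = N.+1%:R%:E * b)%E.
  by move=> -> b0; rewrite -{1}[b]mul1e -ge0_muleDl ?lee_fin// -EFinD addrC -natr1.
exists N.+1; split.
- rewrite haar_compactU//; [|exact/cs/finite_set1|exact/cs/finite_seq|].
    by rewrite muN; apply: muS => //; exact: haar_translate.
  rewrite -subset0 => _ [[w Ww [_ -> <-]]] [w' Ww' [y sy /= e]]; apply: Wsx.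
  exists (w^-1 * w'); first by apply: WM => //; exact: WV.
  by exists y => //; rewrite -mulgA e mulKg.
- rewrite haar_compactU//; [|exact/compact_image_qproj/cs/finite_set1
    |exact/compact_image_qproj/cs/finite_seq|].
    rewrite nuN; apply: muS => //; rewrite image_qproj_mulset image_set1.
    by apply: haar_translate => //; exact: compact_image_qproj.
  rewrite -subset0 => _ [[_ [w Ww [_ -> <-]] <-] [_ [w' Ww' [y sy <-]]]].
  (* (w x)^-1 w' y is in c(G); as c(G) is normal, its conjugate w' y (w x)^-1 is
     in c(G) too, hence in W, which puts x in W y. *)
  move=> /esym/qproj_eq cwx; apply: Wsx.
  have /cW Wc := identity_componentJ (w * x)^-1 cwx.
  have {}Wc : W (w' * y * (w * x)^-1).
    by move: Wc; rewrite conjgE invgK !mulgA mulgV mul1g.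
  exists (w^-1 * (w' * y * (w * x)^-1)^-1 * w').
    apply: (WM) => //; apply: (WM); exact: (WV).
  exists y => //.
  by rewrite !invgM !invgK !mulgA mulVg mul1g !mulgVK.
Qed.

(** The constant is nu(pi(W)) / mu(W). *)
Lemma haar_saturated : exists2 c : R, (0 < c)%R &
  forall T, compact T -> mulset W T = T -> nu (qproj @` T) = (c%:E * mu T)%E.
Proof.
have [W1 _ _] := subgroupW.
have nW : nbhs 1 W by exact: open_nbhs_nbhs.
have nqW : nbhs 1 (qproj @` W) by exact: (qproj_nbhs nW).
have hQ := @component_quotient_hausdorff G.
have cqW : compact (qproj @` W) by exact: compact_image_qproj.
have muW0 := haar_compact_gt0 hausdorffG haar_mu compactW nW.
have nuW0 := haar_compact_gt0 hQ haar_nu cqW nqW.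
have muWf := haar_compact_fin haar_mu compactW.
have nuWf := haar_compact_fin haar_nu cqW.
have muWr : (0 < fine (mu W))%R by rewrite fine_gt0// ltey_eq muWf muW0.
exists (fine (nu (qproj @` W)) / fine (mu W))%R.
  by rewrite divr_gt0// fine_gt0// ltey_eq nuWf nuW0.
move=> T cT WT; have [s Ts] := compact_mulset_cover cT nW.
(* Only the cosets that meet T are kept; W T = T makes them lie inside T. *)
pose t := [seq x <- s | `[< T x >]].
suff -> : T = mulset W [set` t].
  have [N [-> ->]] := haar_coset_count t.
  rewrite -[in LHS](fineK nuWf) -[mu W in RHS](fineK muWf) -!EFinM.
  congr EFin; rewrite mulrCA; congr (_ * _)%R.
  by rewrite divfK// gt_eqF.
apply/seteqP; split=> [x Tx|_ [w Ww [x /= + <-]]].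
  have [w Ww [y /= sy wyx]] := Ts _ Tx; exists w => //; exists y => //=.
  rewrite mem_filter sy andbT; apply/asboolP; rewrite -WT.
  exists w^-1; first by case: subgroupW => _ _; apply.
  by exists x => //; rewrite -wyx mulKg.
by rewrite mem_filter => /andP[/asboolP Tx _]; rewrite -WT; exists w => //; exists x.
Qed.

End CosetCounting.

(** * Exponential growth rates *)

Section GrowthRate.
Context {R : realType}.
Implicit Types u v : nat -> \bar R.
Local Open Scope ereal_scope.

Lemma limn_esup_le_eps u v :
  (forall e : R, (0 < e)%R -> \forall n \near \oo, u n <= v n + e%:E) ->
  limn_esup u <= limn_esup v.
Proof.
move=> uv; apply/lee_addgt0Pr => e e0; rewrite -leeBlDr//.
rewrite [leRHS]limf_esupE; apply: le_ereal_inf_tmp => _ [V nV <-].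
rewrite leeBlDr//; have nUV := filterI (uv e e0) nV.
rewrite [leLHS]limf_esupE; apply: ge_ereal_inf.
exists (ereal_sup (u @` ([set n | u n <= v n + e%:E] `&` V))).
  by exists ([set n | u n <= v n + e%:E] `&` V) => //; exact: nUV.
apply: ge_ereal_sup => _ [n [uvn Vn] <-]; apply: le_trans uvn _.
by apply: leeD => //; apply: ereal_sup_ubound; exists n.
Qed.

(** The factor c contributes ln c / n, which tends to 0.  The case n = 0 is left
    out of the hypothesis because trajectories of length 0 are reduced to 1
    and are not W-saturated. *)
Lemma log_growth_le u v (c : R) : (0 < c)%R ->
  (forall n, (0 < n)%N -> 0 <= v n /\ u n <= c%:E * v n) ->
  limn_esup (fun n => lne (u n) * (n%:R^-1)%:E) <=
  limn_esup (fun n => lne (v n) * (n%:R^-1)%:E).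
Proof.
move=> c0 uv; apply: limn_esup_le_eps => e e0; near=> n.
have n0 : (0 < n)%N by near: n; exact: nbhs_infty_gt.
have nV0 : (0 < (n%:R^-1 : R))%R by rewrite invr_gt0 ltr0n.
have [v0 ucv] := uv n n0.
(* lne is -oo on nonpositive values. *)
have [u0|u0] := leP (u n) 0.
  by rewrite le0_lneNy// gt0_mulNye ?lte_fin// leNye.
have vpos : 0 < v n.
  by rewrite lt0e v0 andbT; apply/eqP => v00; move: ucv; rewrite v00 mule0 leNgt u0.
have lec : lne (u n) <= (ln c)%:E + lne (v n).
  rewrite -lne_EFin// -lneM ?lee_lne ?in_itv/= ?leey ?andbT ?lte_fin//.
    exact: ltW.
  by rewrite mule_ge0 ?lee_fin// ltW.
apply: le_trans (lee_wpmul2r _ lec) _; first by rewrite lee_fin ltW.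
rewrite muleDl//.
rewrite addeC leeD2l// -EFinM lee_fin.
rewrite ler_pdivrMr ?ltr0n// -ler_pdivrMl//.
by near: n; exact: nbhs_infty_ger.
Unshelve. all: by end_near. Qed.

End GrowthRate.

(** * Trajectories *)

Section Trajectory.
Context {G : topologicalGroupType}.
Implicit Types A B U V W : set G.

Lemma compact_trajectory (phi : G -> G) U n : continuous phi -> compact U ->
  compact (trajectory phi U n).
Proof.
move=> cphi cU; rewrite /trajectory; elim/big_ind : _ => //.
- exact: compact_set1.
- exact: compact_mulset.
- move=> i _; elim: (nat_of_ord i) => [|k IH]; first by rewrite image_id.
  have -> : iter k.+1 phi @` U = phi @` (iter k phi @` U) by rewrite image_comp.
  by apply: continuous_compact => //; exact: continuous_subspaceT.
Qed.

Lemma trajectoryS (phi : G -> G) U V n : U `<=` V ->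
  trajectory phi U n `<=` trajectory phi V n.
Proof.
move=> UV; rewrite /trajectory; elim/big_ind2 : _ => //.
- by move=> A B C D AB CD; exact: mulsetS.
- by move=> i _; exact: image_subset.
Qed.

Lemma mulset_trajectory (phi : G -> G) W U n : mulset W U = U -> (0 < n)%N ->
  mulset W (trajectory phi U n) = trajectory phi U n.
Proof.
case: n => // n WU _; rewrite /trajectory big_ord_recl /= mulsetA.
by rewrite image_id WU.
Qed.

Lemma image_qproj_trajectory (phi : {multiplicative G -> G}) U n :
  continuous phi ->
  qproj @` trajectory phi U n = trajectory (component_map phi) (qproj @` U) n.
Proof.
move=> cphi; rewrite /trajectory; elim/big_ind2 : _.
- by rewrite image_set1.
- by move=> A B C D; rewrite image_qproj_mulset => -> ->.
- move=> i _; rewrite !image_comp; apply: eq_imagel => x _ /=.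
  by elim: (nat_of_ord i) => //= k <-; rewrite component_map_qproj.
Qed.

Lemma component_map_continuous (phi : {multiplicative G -> G}) :
  continuous phi -> continuous (component_map phi).
Proof.
move=> cphi q A; rewrite -{1}(qproj_repr q) component_map_qproj// => nA.
have : nbhs (repr q) (phi @^-1` (qproj @^-1` A)).
  by apply: (cphi (repr q) (qproj @^-1` A)); exact: qproj_continuous.
move=> /qproj_nbhs; rewrite qproj_repr; apply: filterS => _ [x Ax <-] /=.
by rewrite component_map_qproj.
Qed.

End Trajectory.

(** * Comparison of the entropies *)

Section EntropyQuotient.
Context {R : realType} {G : topologicalGroupType}.
Hypothesis hausdorffG : hausdorff_space G.
Variable mu : {measure set (g_sigma_algebraType (@open G)) -> \bar R}.
Variable nu : {measure set (g_sigma_algebraType (@open (component_quotient G)))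
  -> \bar R}.
Hypothesis haar_mu : right_haar_measure mu.
Hypothesis haar_nu : right_haar_measure nu.
Variable W : set G.
Hypothesis subgroupW : is_subgroup W.
Hypothesis compactW : compact W.
Hypothesis openW : open W.

(** Replacing U by W U enlarges the trajectories, so the supremum defining either
    entropy may be computed along the sets W U, where the measures of the
    trajectories in G and in the quotient are proportional. *)
Lemma algebraic_entropy_component (phi : {multiplicative G -> G}) :
  continuous phi ->
  algebraic_entropy mu phi = algebraic_entropy nu (component_map phi).
Proof.
move=> cphi; have [W1 _ _] := subgroupW.
have nW : nbhs 1 W by exact: open_nbhs_nbhs.
have hQ := @component_quotient_hausdorff G.
have cbar := component_map_continuous cphi.
have [c c0 muc] := haar_saturated hausdorffG haar_mu haar_nu subgroupW compactW openW.
have sat U : mulset W (mulset W U) = mulset W U.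
  by rewrite mulsetA mulset_subgroup.
have key U n : compact U -> (0 < n)%N ->
    nu (trajectory (component_map phi) (qproj @` mulset W U) n) =
    (c%:E * mu (trajectory phi (mulset W U) n))%E.
  move=> cU n0; rewrite -image_qproj_trajectory// muc//.
    by apply: compact_trajectory => //; exact: compact_mulset.
  exact: mulset_trajectory.
have sup U : U `<=` mulset W U by exact: mulset_subset.
apply/eqP; rewrite eq_le; apply/andP; split; apply: ge_ereal_sup => _ [U [cU nU] <-].
- have cWU := compact_mulset compactW cU.
  have nWU : nbhs 1 (mulset W U) by exact: filterS nU.
  apply: le_ereal_sup_tmp; exists (entropy_at nu (component_map phi) (qproj @` mulset W U)).
    exists (qproj @` mulset W U) => //; split; first exact: compact_image_qproj.
    exact: (qproj_nbhs nWU).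
  have cV0 : (0 < c^-1)%R by rewrite invr_gt0.
  apply: (log_growth_le cV0) => n n0; split=> //.
  rewrite key// muleA -EFinM mulVf ?gt_eqF// mul1e.
  by apply: haar_compact_le; rewrite //; [exact: compact_trajectory..|exact: trajectoryS].
- have [V [cV nV UV]] := qproj_compact_lift subgroupW compactW openW cU.
  have cWV := compact_mulset compactW cV.
  have nWV : nbhs 1 (mulset W V) by exact: filterS nV.
  apply: le_ereal_sup_tmp; exists (entropy_at mu phi (mulset W V)).
    by exists (mulset W V).
  apply: (log_growth_le c0) => n n0; split=> //; rewrite -key//.
  apply: haar_compact_le; rewrite //; [|exact/compact_trajectory/compact_image_qproj|].
    exact: compact_trajectory.
  by apply: trajectoryS; apply: subset_trans UV _; exact: image_subset.
Qed.

End EntropyQuotient.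

(** A continuous map fixing 1 sends c(G) into itself; this applies to phi and to
    its inverse. *)
Lemma automorphism_identity_component (G : topologicalGroupType)
    (phi : {multiplicative G -> G}) :
  topological_automorphism phi ->
  phi @` identity_component G = identity_component G.
Proof.
move=> [cphi [psi [phiK psiK cpsi]]].
have c1 := @identity_component1 G.
have phi1 : phi 1 = 1 by apply: (mulgI (phi 1)); rewrite -gmulfM !mulg1.
have psi1 : psi 1 = 1 by rewrite -[in LHS]phi1 phiK.
apply/seteqP; split=> [_ [x cx <-]|x cx].
  by apply: (connected_image_component cphi c1) cx; rewrite phi1.
exists (psi x) => //.
by apply: (connected_image_component cpsi c1) cx; rewrite psi1.
Qed.

Theorem corollary5p6 (R : realType) (G : topologicalGroupType)
    (hausdorffG : hausdorff_space G)
    (locally_compactG : locally_compact [set: G])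
    (compactly_coveredG : compactly_covered G)
    (quasihamiltonianG : topologically_quasihamiltonian G) :
  (forall phi : {multiplicative G -> G},
    continuous phi ->
    phi @` identity_component G = identity_component G ->
    phi @^-1` [set 1] `<=` identity_component G ->
    forall (mu : {measure set (g_sigma_algebraType (@open G)) -> \bar R})
           (nu : {measure set (g_sigma_algebraType
                    (@open (component_quotient G))) -> \bar R}),
      right_haar_measure mu -> right_haar_measure nu ->
      algebraic_entropy mu phi = algebraic_entropy nu (component_map phi))
  /\
  (forall phi : {multiplicative G -> G},
    topological_automorphism phi ->
    phi @` identity_component G = identity_component G /\
    forall (mu : {measure set (g_sigma_algebraType (@open G)) -> \bar R})
           (nu : {measure set (g_sigma_algebraType
                    (@open (component_quotient G))) -> \bar R}),
      right_haar_measure mu -> right_haar_measure nu ->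
      algebraic_entropy mu phi = algebraic_entropy nu (component_map phi)).
Proof.
have [W [sW cW oW]] := exists_compact_open_subgroup hausdorffG locally_compactG
  compactly_coveredG quasihamiltonianG.
split=> phi; first move=> cphi _ _ mu nu hmu hnu.
  exact: (algebraic_entropy_component hausdorffG hmu hnu sW).
move=> aphi; split=> [|mu nu hmu hnu]; first exact: automorphism_identity_component.
have [cphi _] := aphi.
exact: (algebraic_entropy_component hausdorffG hmu hnu sW).
Qed.
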